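(* Let $G$ be a group acting on a finite set $X$. Then $$\mathrm{Rank}(\mathrm{Aut}_G(X))\le |\mathrm{Conj}_G(X)|-\kappa_G(X)+\Lambda_G(X)+\lambda_G^{\min}(X).$$
   Context: $\mathrm{Aut}_G(X)$ is the group of $G$-equivariant bijections $X\to X$. $G_x$ is the stabilizer of $x$. For $H\le G$, $[H]$ is its conjugacy class in $G$, $N_G(H)$ its normalizer, and $\mathcal{B}_{[H]}=\{x\in X:[G_x]=[H]\}$ (a ''box''). $\mathrm{Conj}_G(X)=\{[G_x]:x\in X\}=\{[H_1],\dots,[H_r]\}$. $G/\mathcal{B}_{[H]}$ denotes the set of $G$-orbits in $\mathcal{B}_{[H]}$. $\mathrm{Rank}$ of a group is the minimum cardinality of a generating set, with the convention that the trivial group has rank $1$. $\kappa_G(X)$ is the number of $[H]\in\mathrm{Conj}_G(X)$ with $|G/\mathcal{B}_{[H]}|=1$. $\Lambda_G(X)=1$ if ($|\mathrm{Conj}_G(X)|=\kappa_G(X)$ and $N_G(H)/H\cong 1$ for all $[H]\in\mathrm{Conj}_G(X)$) or if some $[H]\in\mathrm{Conj}_G(X)$ has $|G/\mathcal{B}_{[H]}|\ge 3$; otherwise $\Lambda_G(X)=0$. For each $i\in\{1,\dots,r\}$ fix a point $x^i\in X$ with $G_{x^i}=H_i$ and a generating set $\{n^i_1H_i,\dots,n^i_{r_i}H_i\}$ of minimal cardinality of the finite group $N_G(H_i)/H_i$. For $n\in N_G(H_i)$, $(x^i\to n\cdot x^i)$ denotes the $G$-equivariant bijection of $X$ sending $h\cdot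 x^i$ to $hn\cdot x^i$ for $h\in G$ and fixing all points outside the orbit $Gx^i$. The base generators are $\eta^i_k=(x^i\to n^i_k\cdot x^i)$, $1\le i\le r$, $1\le k\le r_i$. Let $o(\cdot)$ denote the order of an element and $\mathcal{B}=\{\eta^i_k: 1\le i\le r,\ 1\le k\le r_i,\ o(\eta^i_k)>1\}$. A packet is a subset of $\mathcal{B}$ whose elements have pairwise coprime orders and which does not contain two generators with the same superscript $i$. $\lambda_G^{\min}(X)$ is the minimum number of packets in a partition of $\mathcal{B}$ into disjoint packets. *)

(* Defs.v *)
From HB Require Import structures.
From mathcomp Require Import all_boot all_fingroup all_solvable finmap.
From mathcomp Require Import boolp classical_sets.

Set Implicit Arguments.
Unset Strict Implicit.
Unset Printing Implicit Defensive.

Import GroupScope.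
Local Open Scope group_scope.
Local Open Scope fset_scope.
Local Open Scope quotient_scope.

(* G is an arbitrary, possibly infinite, group: subgroups of G are elements   *)
(* of [groupClosed G], and the normaliser and quotient constructions of       *)
(* fingroup, which require a finite ambient group, are redone for them.       *)

Section AbstractGroups.
Variable G : groupType.
Implicit Type H K : groupClosed G.

Definition conjset H (g : G) : set G := [set h ^ g | h in [set` H]]%classic.

Definition conj_class H : set (set G) := range (conjset H).

Definition normaliser H : {pred G} :=
  [pred n | `[< conjset H n = [set` H]%classic >]].

Lemma normaliserP H n :
  reflect (forall h, (h ^ n \in H) = (h \in H)) (n \in normaliser H).
Proof.
apply: (iffP (asboolP _)) => [E h | E].
  have memE z : (z \in H) <-> conjset H n z by rewrite E.
  apply/idP/idP => [/memE[h' Hh' /conjg_inj <-] // | Hh].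
  by apply/memE; exists h.
apply/seteqP; split => [_ [h Hh <-] | h Hh] /=; first by rewrite E.
by exists (h ^ n^-1); [rewrite /= -E |]; rewrite conjgKV.
Qed.

Lemma normaliser_group_closed H : group_closed (normaliser H).
Proof.
split=> [|a b /normaliserP Ea /normaliserP Eb].
  by apply/normaliserP => h; rewrite conjg1.
by apply/normaliserP => h; rewrite conjgM -[LHS]Eb conjgKV Ea.
Qed.

Definition normaliser_of H := {n : G | n \in normaliser H}.

HB.instance Definition _ H := SubChoice.on (normaliser_of H).
HB.instance Definition _ H :=
  SubChoice_isSubGroup.Build G (normaliser H) (normaliser_of H)
    (normaliser_group_closed H).

Definition coset_rel H : rel (normaliser_of H) :=
  fun a b => (val a)^-1 * val b \in H.

Lemma coset_rel_equiv H : equiv_class_of (@coset_rel H).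
Proof.
split=> [a | a b | b a c]; rewrite /coset_rel.
- by rewrite mulVg gpred1.
- by rewrite -gpredV invgM invgK.
move=> Hab Hbc.
by have := gpredM _ _ Hab Hbc; rewrite -mulgA mulKVg.
Qed.

Canonical coset_equiv H := EquivRelPack (coset_rel_equiv H).

(* The quotient group N_G(H) / H; the coset n H of n is [\pi_(weyl H) n].     *)
Definition weyl H := {eq_quot (@coset_rel H)}.

HB.instance Definition _ H := Choice.on (weyl H).
HB.instance Definition _ H := EqQuotient.on (weyl H).

Definition weyl_mul H := lift_op2 (weyl H) (fun a b : normaliser_of H => a * b).
Definition weyl_inv H := lift_op1 (weyl H) (fun a : normaliser_of H => a^-1).
Definition weyl_one H := lift_cst (weyl H) (1 : normaliser_of H).

Lemma weyl_piP H (a b : normaliser_of H) :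
  reflect (\pi_(weyl H) a = \pi_(weyl H) b) ((val a)^-1 * val b \in H).
Proof. by apply: (iffP idP) => [|/eqmodP //] Hab; apply/eqmodP. Qed.

Lemma pi_weyl_mul H : {morph \pi_(weyl H) : a b / a * b >-> weyl_mul a b}.
Proof.
move=> a b; rewrite /weyl_mul; unlock; apply/weyl_piP.
set a' := generic_quotient.repr _; set b' := generic_quotient.repr _.
have /weyl_piP Ha : \pi_(weyl H) a = \pi_(weyl H) a' by rewrite reprK.
have /weyl_piP Hb : \pi_(weyl H) b = \pi_(weyl H) b' by rewrite reprK.
rewrite !valM invgM.
have /normaliserP/(_ ((val a)^-1 * val a')) := valP b'; rewrite Ha => Hc.
have := gpredM _ _ Hb Hc.
by rewrite /conjg !mulgA mulgK.
Qed.
Canonical pi_weyl_mul_morph H := PiMorph2 (@pi_weyl_mul H).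

Lemma pi_weyl_inv H : {morph \pi_(weyl H) : a / a^-1 >-> weyl_inv a}.
Proof.
move=> a; rewrite /weyl_inv; unlock; apply/weyl_piP.
set a' := generic_quotient.repr _.
have /weyl_piP Ha : \pi_(weyl H) a = \pi_(weyl H) a' by rewrite reprK.
have /normaliserP/(_ ((val a)^-1 * val a')) := valP (a'^-1).
rewrite Ha -gpredV => Hc.
have valV (c : normaliser_of H) : val c^-1 = (val c)^-1.
  by apply: (mulgI (val c)); rewrite -valM !mulgV.
by move: Hc; rewrite /conjg !valV !invgM !invgK mulgA mulgV mul1g.
Qed.
Canonical pi_weyl_inv_morph H := PiMorph1 (@pi_weyl_inv H).
Canonical pi_weyl_one_morph H := PiConst (weyl_one H).

Lemma weyl_mulA H : associative (@weyl_mul H).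
Proof. by elim/quotW=> a; elim/quotW=> b; elim/quotW=> c; rewrite !piE mulgA. Qed.
Lemma weyl_mul1g H : left_id (weyl_one H) (@weyl_mul H).
Proof. by elim/quotW=> a; rewrite !piE mul1g. Qed.
Lemma weyl_mulg1 H : right_id (weyl_one H) (@weyl_mul H).
Proof. by elim/quotW=> a; rewrite !piE mulg1. Qed.
Lemma weyl_mulVg H : left_inverse (weyl_one H) (@weyl_inv H) (@weyl_mul H).
Proof. by elim/quotW=> a; rewrite !piE mulVg. Qed.
Lemma weyl_mulgV H : right_inverse (weyl_one H) (@weyl_inv H) (@weyl_mul H).
Proof. by elim/quotW=> a; rewrite !piE mulgV. Qed.

HB.instance Definition _ H := isGroup.Build (weyl H)
  (@weyl_mulA H) (@weyl_mul1g H) (@weyl_mulg1 H) (@weyl_mulVg H) (@weyl_mulgV H).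

Lemma pi_weylM H (a b : normaliser_of H) :
  \pi_(weyl H) (a * b) = \pi_(weyl H) a * \pi_(weyl H) b.
Proof. exact: pi_weyl_mul. Qed.

Definition generates (S : set G) : Prop :=
  forall K, (forall g, S g -> g \in K) -> forall g, g \in K.

(* [maxn 1] is the convention that the trivial group has rank 1; a minimal    *)
(* family of generators of the trivial group is thus empty or a singleton.    *)
Definition min_generating m (f : 'I_m -> G) : Prop :=
  generates (range f) /\
  forall m' (f' : 'I_m' -> G), generates (range f') -> m <= maxn 1 m'.

End AbstractGroups.

Record left_action (G : groupType) (X : Type) := LeftAction {
  lact :> G -> X -> X;
  lact1 : forall x, lact 1 x = x;
  lactM : forall g h x, lact (g * h) x = lact g (lact h x)
}.

Section Action.
Variables (G : groupType) (X : finType) (act : left_action G X).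

Definition stab_pred (x : X) : {pred G} := [pred g | act g x == x].

Lemma stab_group_closed x : group_closed (stab_pred x).
Proof.
split=> [|a b]; rewrite !inE ?lact1 // => /eqP Ea /eqP Eb.
suff Vb : act b^-1 x = x by rewrite lactM Vb Ea.
by rewrite -{1}Eb -lactM mulVg lact1.
Qed.

Definition stab x : groupClosed G :=
  HB.pack_for (groupClosed G) (stab_pred x)
    (isInvClosed.Build G (stab_pred x) (group_closedV (stab_group_closed x)))
    (isMul1Closed.Build G (stab_pred x) (stab_group_closed x).1)
    (isMulClosed.Build G (stab_pred x) (group_closedM (stab_group_closed x))).

Lemma in_stab x g : (g \in stab x) = (act g x == x).
Proof. by []. Qed.

Definition Conj : {fset set (set G)} := [fset conj_class (stab x) | x in X].

Definition box (c : set (set G)) : {set X} := [set x | conj_class (stab x) == c].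

Definition Gorbit (x : X) : {set X} := [set y | `[< exists g, y = act g x >]].

Definition orbits_in (B : {set X}) : {set {set X}} := [set Gorbit x | x in B].

Definition kappa : nat := #|` [fset c in Conj | #|orbits_in (box c)| == 1%N]|.

Definition Lambda : nat :=
  `[< (#|` Conj| = kappa /\
        forall H : groupClosed G, conj_class H \in Conj -> forall q : weyl H, q = 1)
      \/ (exists2 c, c \in Conj & 3 <= #|orbits_in (box c)|) >].

Definition AutG : {set {perm X}} :=
  [set s : {perm X} | `[< forall g x, s (act g x) = act g (s x) >]].

Lemma AutG_group_set : group_set AutG.
Proof.
apply/group_setP; split=> [|s t]; rewrite !inE.
  by apply/asboolP => g x; rewrite !perm1.
move=> /asboolP Es /asboolP Et; apply/asboolP => g x.
by rewrite !permM Es Et.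
Qed.
Canonical AutG_group := Group AutG_group_set.

Section Eta.
Variables (x : X) (n : normaliser_of (stab x)).

(* The value at h x does not depend on the choice of h: see [etaE] below.     *)
Definition eta_fun (y : X) : X :=
  match pselect (exists h, act h x = y) with
  | left ex => act (projT1 (cid ex) * val n) x
  | right _ => y
  end.

Lemma act_eq (a b : G) z : (act a z == act b z) = (b^-1 * a \in stab z).
Proof.
rewrite in_stab lactM; apply/eqP/eqP => [-> | E].
  by rewrite -lactM mulVg lact1.
by rewrite -{2}E -lactM mulgV lact1.
Qed.

Lemma eta_fun_eq (a b : G) :
  (act (a * val n) x == act (b * val n) x) = (act a x == act b x).
Proof.
rewrite !act_eq -[RHS](normaliserP _ _ (valP n)) /conjg.
by rewrite invgM !mulgA.
Qed.

Lemma eta_funE h : eta_fun (act h x) = act (h * val n) x.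
Proof.
rewrite /eta_fun; case: pselect => [ex|[]]; last by exists h.
by apply/eqP; rewrite eta_fun_eq; case: cid => h' /= ->.
Qed.

Lemma eta_fun_out y : ~ (exists h, act h x = y) -> eta_fun y = y.
Proof. by rewrite /eta_fun; case: pselect. Qed.

Lemma eta_fun_inj : injective eta_fun.
Proof.
move=> y z.
have [[a <-]|Ny] := pselect (exists h, act h x = y);
have [[b <-]|Nz] := pselect (exists h, act h x = z).
- by rewrite !eta_funE => /eqP; rewrite eta_fun_eq => /eqP.
- by rewrite eta_funE eta_fun_out // => E; case: Nz; exists (a * val n).
- by rewrite eta_funE eta_fun_out // => E; case: Ny; exists (b * val n).
- by rewrite !eta_fun_out.
Qed.

(* The permutation (x -> n x).                                                *)
Definition eta : {perm X} := perm eta_fun_inj.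

Lemma etaE h : eta (act h x) = act (h * val n) x.
Proof. by rewrite permE eta_funE. Qed.

Lemma eta_out y : ~ (exists h, act h x = y) -> eta y = y.
Proof. by move=> Ny; rewrite permE eta_fun_out. Qed.

End Eta.

End Action.

Arguments eta {G X} act x n.

Definition Rank (gT : finGroupType) (A : {group gT}) : nat := maxn 1 'm(A).

Section Packets.
Variables (gT : finGroupType) (r : nat) (m : 'I_r -> nat).
Variable e : forall i : 'I_r, 'I_(m i) -> gT.

Definition base : {set gT} :=
  [set s | [exists i, [exists k, s == e (i := i) k]] && (1 < #[s])].

Definition packet (P : {set gT}) : bool :=
  [&& P \subset base,
      [forall s in P, [forall t in P, (s != t) ==> coprime #[s] #[t]]] &
      [forall i, [forall k : 'I_(m i), [forall l : 'I_(m i),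
         (e k \in P) && (e l \in P) ==> (e k == e l)]]]].

Definition packet_partition (P : {set {set gT}}) : bool :=
  finset.partition P base && [forall Q in P, packet Q].

(* The default value of [arg min] is itself a partition into packets.         *)
Definition lambda_min : nat :=
  #|[arg min_(P < [set [set s] | s in base] | packet_partition P) #|P|]|.

Lemma packet_partition1 : packet_partition [set [set s] | s in base].
Proof.
apply/andP; split.
  apply/and3P; split.
  - apply/eqP/setP => s; apply/bigcupP/idP => [[_ /imsetP[t Bt ->]]|Bs].
      by rewrite inE => /eqP ->.
    by exists [set s]; rewrite ?inE ?imset_f.
  - apply/finset.trivIsetP => _ _ /imsetP[s _ ->] /imsetP[t _ ->] nst.
    by rewrite disjoints1 inE; apply: contraNN nst => /eqP->.
  - by apply/imsetP => -[s _ /setP/(_ s)]; rewrite !inE eqxx.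
apply/forall_inP => _ /imsetP[s Bs ->]; apply/and3P; split.
- by rewrite finset.sub1set.
- apply/forall_inP => t /set1P->; apply/forall_inP => u /set1P->.
  by rewrite eqxx.
- do 3!apply/forallP => ?; apply/implyP => /andP[/set1P-> /set1P->].
  exact: eqxx.
Qed.

Lemma lambda_minP P : packet_partition P -> lambda_min <= #|P|.
Proof.
move=> HP; rewrite /lambda_min; case: arg_minnP => [|Q _ minQ].
  exact: packet_partition1.
exact: minQ.
Qed.

End Packets.

(* Main.v *)
(* A G-equivariant permutation of X permutes the orbits inside each box, and  *)
(* is determined by its values on one representative per orbit. Correcting    *)
(* these values one at a time, Aut_G(X) is generated by the base generators,  *)
(* which generate the copy of N_G(H_i)/H_i acting on the orbit of x^i, and by *)
(* the lifts of the transpositions of representatives in a common box. The    *)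
(* elements of a packet commute and have coprime orders, so that their        *)
(* product generates all of them. As for the transpositions, the symmetric    *)
(* group of each box with at least two orbits is generated by an involution d *)
(* and an element c of odd order, c being trivial if there are only two       *)
(* orbits; with t such boxes, the t + 1 products c_1, d_1 c_2, ...,           *)
(* d_(t-1) c_t, d_t suffice, and the t elements d_i do if all c_i are         *)
(* trivial.                                                                   *)

From HB Require Import structures.
Require Import Defs.
From mathcomp Require Import all_boot all_fingroup all_solvable finmap.
From mathcomp Require Import boolp classical_sets.

Set Implicit Arguments.
Unset Strict Implicit.
Unset Printing Implicit Defensive.

(** Write t for the number of boxes with at least two orbits; as no box is empty, this is |Conj| -
    kappa ([card_Conj_kappa]). [Aut_gen] reduces the theorem to two families: the base generators,
    for which one element per packet is enough ([packets_gen]), and the lifted transpositions of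
    orbit representatives, for which t elements are enough, or t + 1 if some box has at least three
    orbits ([box_symmetries_gen]). Both savings rest on [coprime_commute_gen]: a product of
    commuting elements of coprime orders generates both factors.

    If some box has three orbits, Lambda is 1 and pays for the extra element. Otherwise t + lambda
    bounds the minimal number of generators, and only the convention that the trivial group has rank
    1 is left to check: if the whole right-hand side were 0, Aut_G(X) would be trivial, every box a
    single orbit and every N_G(H)/H trivial, so that Lambda would be 1. *)

Local Open Scope nat_scope.

(** * Products of commuting elements of coprime orders *)

Section FiniteGroups.
Local Open Scope group_scope.
Variable gT : finGroupType.
Implicit Types (a b g : gT).

Lemma coprime_commute_gen a b (K : {group gT}) :
  commute a b -> coprime #[a] #[b] -> a * b \in K -> (a \in K) && (b \in K).
Proof.
move=> cab co; rewrite -!cycle_subG => sK; apply/andP; split.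
  exact: fintype.subset_trans (cycleMsub cab co) sK.
apply: fintype.subset_trans _ sK.
by rewrite cab cycleMsub // coprime_sym.
Qed.

(** The witness is the product of [s]. The first two clauses carry the induction: the first makes
    [g] commute with the next element, the second makes their orders coprime. *)
Lemma coprime_commuting_cyclic (s : seq gT) :
    {in s &, forall a b, commute a b} ->
    {in s &, forall a b, a != b -> coprime #[a] #[b]} -> uniq s ->
  exists g, [/\ g \in <<[set a in s]>>, #[g] %| \prod_(a <- s) #[a]
               & {subset s <= <[g]>}].
Proof.
elim: s => [|a s IHs] cs os; first by exists 1; rewrite group1 order1.
case/andP => as_ us.
have [b c||g [gs og sg]] := IHs _ _ us.
- by move=> bs cs'; apply: cs; rewrite inE ?bs ?cs' orbT.
- by move=> b c bs cs'; apply: os; rewrite inE ?bs ?cs' orbT.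
have cag : commute a g.
  suff: g \in 'C[a] by move/cent1P.
  move: g gs {og sg}; apply/fintype.subsetP; rewrite gen_subG.
  apply/fintype.subsetP => b; rewrite inE => bs; apply/cent1P.
  by apply: cs; rewrite inE ?eqxx ?bs ?orbT.
have oag : coprime #[a] #[g].
  apply: coprime_dvdr og _; rewrite big_seq; elim/big_ind: _ => [||b bs].
  - exact: coprimen1.
  - by move=> i j; rewrite coprimeMr => -> ->.
  by apply: os; rewrite ?inE ?eqxx ?bs ?orbT //; apply: contraNneq as_ => ->.
have /andP[Ha Hg] := coprime_commute_gen cag oag (cycle_id (a * g)).
exists (a * g); split.
- apply: groupM; first by rewrite mem_gen // inE mem_head.
  move: g gs {og sg cag oag Ha Hg}; apply/fintype.subsetP/genS/fintype.subsetP => b.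
  by rewrite !inE => ->; rewrite orbT.
- by rewrite big_cons (orderM cag oag) dvdn_mul.
move=> b; rewrite inE => /predU1P[-> //|/sg]; move: b; apply/fintype.subsetP.
by rewrite cycle_subG.
Qed.

(* Each [d i] is merged with the [c j] of the next index [j] of [l]; their    *)
(* orders are coprime.                                                        *)
Lemma interleaved_gen (I : eqType) (c d : I -> gT) (l : seq I) b :
    b ^+ 2 = 1 -> (forall i, odd #[c i] /\ d i ^+ 2 = 1) ->
    {in l, forall i, commute b (c i)} ->
    (forall i j, i != j -> commute (d i) (c j)) -> uniq l ->
  exists2 S : {set gT}, #|S| <= (size l).+1 &
    forall K : {group gT}, S \subset K <->
      b \in K /\ {in l, forall i, c i \in K /\ d i \in K}.
Proof.
move=> b2 ocd + dc; elim: l b b2 => [|i l IHl] b b2 bc.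
  exists [set b]; rewrite ?cards1 // => K; rewrite finset.sub1set.
  by split=> [|[]].
case/andP => il ul; have [oci di2] := ocd i.
(* [b] is the involution still waiting for a partner. It is merged with [c i], and [d i] waits in
   its place; the one left at the end costs the extra generator. *)
have [|S cS genS] := IHl (d i) di2 _ ul.
  by move=> j jl; apply: dc; apply: contraNneq il => ->.
exists (b * c i |: S) => [|K].
  by rewrite (leq_trans (leq_card_setU _ _)) // cards1.
have bci : commute b (c i) by apply: bc; rewrite mem_head.
have co : coprime #[b] #[c i].
  apply: (@coprime_dvdl _ 2); first by rewrite order_dvdn b2.
  by rewrite coprime2n.
rewrite finset.subUset finset.sub1set; split=> [/andP[bcK /genS[dK lK]]|[bK lK]].
  have /andP[bK cK] := coprime_commute_gen bci co bcK.
  by split=> // j; rewrite inE => /predU1P[-> //|/lK].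
have [cK dK] := lK i (mem_head _ _); rewrite groupM //=.
by apply/genS; split=> // j jl; apply: lK; rewrite inE jl orbT.
Qed.

End FiniteGroups.

(** * Generating a symmetric group by an involution and a cycle of odd order *)

Section OddCycles.
Local Open Scope group_scope.
Variable T : finType.
Implicit Types (x y z : T) (s : seq T).

(** At the extreme value [k = (size s).+1], [nth] returns its default [y]: the cycle closes up. *)
Lemma iter_next_head y s k :
    uniq (y :: s) -> k <= (size s).+1 ->
  iter k (next (y :: s)) y = nth y (y :: s) k.
Proof.
move=> us; elim: k => // k IHk ks.
rewrite iterS IHk 1?ltnW // next_nth mem_nth // index_uniq //.
Qed.

(** The underlying function is [next s], visible only through its inverse [prev s]. *)
Definition cycle_perm s (us : uniq s) : {perm T} := perm (can_inj (prev_next us)).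

Lemma cycle_perm_iter y s (us : uniq (y :: s)) k :
  (cycle_perm us ^+ k) y = iter k (next (y :: s)) y.
Proof. by rewrite permX; apply: eq_iter => z; rewrite permE. Qed.

Lemma cycle_perm_out s (us : uniq s) z : z \notin s -> cycle_perm us z = z.
Proof. by move=> /negPf zs; rewrite permE next_nth zs. Qed.

Lemma cycle_perm_order y s (us : uniq (y :: s)) :
  #[cycle_perm us] %| (size s).+1.
Proof.
rewrite order_dvdn; apply/eqP/permP => z; rewrite perm1.
have [zs|zs] := boolP (z \in y :: s); last first.
  by elim: (size s).+1 => [|k IHk]; rewrite ?perm1 // expgSr permM IHk cycle_perm_out.
rewrite -(nth_index y zs); move: (index z _) (index_mem z (y :: s)); rewrite zs => k ks.
(* Every entry is the image of [y] under a power of the cycle, so only the return to [y] has to be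
   checked. *)
rewrite -iter_next_head 1?ltnW // -cycle_perm_iter -permM -expgD addnC expgD permM.
congr (_ _); rewrite cycle_perm_iter iter_next_head //.
by rewrite nth_default.
Qed.

(** For distinct points, conjugating (x y) by (y z) gives (x z). *)
Lemma tperm_mem_trans (K : {group {perm T}}) x y z :
  tperm x y \in K -> tperm y z \in K -> tperm x z \in K.
Proof.
have [-> //|nyz] := eqVneq y z; have [-> |nxz] := eqVneq x z; first by rewrite tperm1.
move=> Kxy Kyz; have := groupJ Kxy Kyz; rewrite tpermJ tpermL.
have [->|nxy] := eqVneq x y; first by rewrite tpermL tperm1; move: Kyz.
by rewrite tpermD // eq_sym.
Qed.

(* If #|O| is odd, [c] is a full cycle and [d] swaps two consecutive points;  *)
(* otherwise [c] is a cycle avoiding one point, that [d] swaps with another.  *)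
Lemma Sym_gen_odd_cycle (O : {set T}) :
  exists2 cd : {perm T} * {perm T},
    [/\ perm_on O cd.1, perm_on O cd.2, odd #[cd.1], cd.2 ^+ 2 = 1
      & #|O| <= 2 -> cd.1 = 1] &
    forall K : {group {perm T}}, cd.1 \in K -> cd.2 \in K ->
      {in O &, forall x y, tperm x y \in K}.
Proof.
have memO : O =i enum O by move=> z; rewrite mem_enum.
have := enum_uniq O; have := cardE O; move: (enum O) memO => [|y s] memO cO us.
  exists (1, 1); rewrite /= ?order1 ?expg1n; first by split=> //; exact: perm_on1.
  by move=> K _ _ x y; rewrite memO.
have tperm_onO x z : x \in O -> z \in O -> perm_on O (tperm x z).
  by move=> xO zO; apply/fintype.subsetP=> t; rewrite inE; case: tpermP => [->|->|] //; rewrite eqxx.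
have starK (K : {group {perm T}}) x : {in O, forall z, tperm x z \in K} ->
    {in O &, forall z t, tperm z t \in K}.
  by move=> xK z t /xK xz /xK; apply: tperm_mem_trans; rewrite tpermC.
have next_out (t : seq T) (ut : uniq t) : {subset t <= O} ->
    perm_on O (cycle_perm ut).
  move=> tO; apply/fintype.subsetP => z; rewrite inE; apply: contraR => zO.
  by rewrite cycle_perm_out //; apply: contra zO => /tO.
have [odd_O|even_O] := boolP (odd #|O|).
  exists (cycle_perm us, tperm y (cycle_perm us y)) => [|K /= cK dK].
    have cyO : perm_on O (cycle_perm us) by apply: next_out => z; rewrite memO.
    split=> //=.
    - by apply: tperm_onO; rewrite ?perm_closed // memO mem_head.
    - by apply: dvdn_odd (cycle_perm_order us) _; rewrite -[_.+1]cO.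
    - by rewrite expgS expg1 tperm2.
    move=> O2; apply/eqP; rewrite -order_eq1 -dvdn1.
    have -> : 1%N = (size s).+1; last exact: cycle_perm_order.
    by move: odd_O O2; rewrite cO /=; case: (size s) => [|[]].
  apply: (starK K y) => z; rewrite memO => zs; rewrite -(nth_index y zs).
  rewrite -iter_next_head //; last by rewrite ltnW // -[X in _ < X]/(size (y :: s)) index_mem.
  (* Conjugating [d] by powers of [c] gives all transpositions of consecutive points, which chain
     together from [y]. *)
  rewrite -(cycle_perm_iter us); elim: (index z _) => [|k IHk].
    by rewrite perm1 tperm1.
  apply: tperm_mem_trans IHk _; have := groupJ dK (groupX k cK).
  by rewrite tpermJ -permM -expgS.
case: s memO cO us => [|z s] memO cO; first by rewrite cO in even_O.
move=> us; have [ys uzs] : y \notin z :: s /\ uniq (z :: s) by apply/andP.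
exists (cycle_perm uzs, tperm y z) => [|K /= cK dK].
  split=> //=.
  - by apply: next_out => t ts; rewrite memO inE ts orbT.
  - by apply: tperm_onO; rewrite memO ?mem_head // !inE eqxx orbT.
  - apply: dvdn_odd (cycle_perm_order uzs) _.
    by move: even_O; rewrite cO /= negbK.
  - by rewrite expgS expg1 tperm2.
  move=> O2; apply/eqP; rewrite -order_eq1 -dvdn1.
  have -> : 1%N = (size s).+1; last exact: cycle_perm_order.
  by move: O2; rewrite cO /=; case: (size s).
apply: (starK K y) => t; rewrite memO inE => /predU1P[->|ts]; first by rewrite tperm1.
rewrite -(nth_index z ts) -iter_next_head //; last by rewrite ltnW // -[X in _ < X]/(size (z :: s)) index_mem.
(* Here [c] fixes [y], so conjugating (y z) by powers of [c] gives every (y t) directly. *)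
rewrite -(cycle_perm_iter uzs); elim: (index t _) => [|k IHk].
  by rewrite perm1.
by have := groupJ IHk cK; rewrite tpermJ cycle_perm_out // -permM -expgSr.
Qed.

End OddCycles.

(** * The permutations [eta] and the quotients N_G(H)/H *)

Section Eta.
Local Open Scope group_scope.
Variables (G : groupType) (X : finType) (act : left_action G X).
Implicit Types (g h : G) (y z : X).

Lemma lactK g : cancel (act g) (act g^-1).
Proof. by move=> y; rewrite -lactM mulVg lact1. Qed.

Lemma lactKV g : cancel (act g^-1) (act g).
Proof. by move=> y; rewrite -lactM mulgV lact1. Qed.

Lemma AutGP (a : {perm X}) :
  reflect (forall g y, a (act g y) = act g (a y)) (a \in AutG act).
Proof. by rewrite inE; apply: asboolP. Qed.

Lemma in_stab_act g h y : (h \in stab act (act g y)) = (h ^ g \in stab act y).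
Proof. by rewrite !in_stab !lactM (can2_eq (lactKV g) (lactK g)). Qed.

Lemma stab_Aut (a : {perm X}) y : a \in AutG act -> stab act (a y) =i stab act y.
Proof. by move=> /AutGP aE h; rewrite !in_stab -aE (inj_eq perm_inj). Qed.

Variable y : X.
Implicit Types m n : normaliser_of (stab act y).

Lemma eta_Aut n : eta act y n \in AutG act.
Proof.
apply/AutGP => g z; have [[h <-]|Nz] := pselect (exists h, act h y = z).
  by rewrite -lactM !etaE -lactM mulgA.
rewrite !eta_out // => -[h hyE]; apply: Nz; exists (g^-1 * h).
by rewrite lactM hyE lactK.
Qed.

Lemma eta_base n : eta act y n y = act (val n) y.
Proof. by have := etaE n 1; rewrite lact1 mul1g. Qed.

(** [eta] multiplies on the right and permutations compose from left to right, so the order of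
    factors is kept. *)
Lemma etaM m n : eta act y (m * n) = eta act y m * eta act y n.
Proof.
apply/permP => z; rewrite permM.
have [[h <-]|Nz] := pselect (exists h, act h y = z); last by rewrite !eta_out.
by rewrite !etaE mulgA.
Qed.

Lemma eta1 : eta act y 1 = 1.
Proof. by apply: (mulgI (eta act y 1)); rewrite -etaM !mulg1. Qed.

(** On the orbit of [y], [eta] is determined by the image of [y]; hence N_G(H)/H embeds in
    Aut_G(X). *)
Lemma pi_weyl_eq_eta m n :
  (\pi_(weyl (stab act y)) m = \pi_(weyl (stab act y)) n)%qT <->
  eta act y m = eta act y n.
Proof.
split=> [/weyl_piP|] mn; last first.
  apply/weyl_piP; rewrite -act_eq -!eta_base mn; exact: eqxx.
apply/permP => z; have [[h <-]|Nz] := pselect (exists h, act h y = z).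
  by rewrite !etaE !lactM; congr (act h _); apply/esym/eqP; rewrite act_eq.
by rewrite !eta_out.
Qed.

Lemma commute_eta z m (n : normaliser_of (stab act z)) :
  (forall g, act g y <> z) -> commute (eta act y m) (eta act z n).
Proof.
move=> yz; apply/permP => t; rewrite !permM.
have [[h <-]|Ny] := pselect (exists h, act h y = t).
  have out k : eta act z n (act k y) = act k y.
    by rewrite eta_out // => -[g E]; apply: (yz (g^-1 * k)); rewrite lactM -E lactK.
  by rewrite out etaE out.
have [[h <-]|Nz] := pselect (exists h, act h z = t); last by rewrite !eta_out.
have out k : eta act y m (act k z) = act k z.
  by rewrite eta_out // => -[g E]; apply: (yz (k^-1 * g)); rewrite lactM E lactK.
by rewrite out etaE out.
Qed.

Section Generation.
Variable K : {group {perm X}}.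

(** The preimage of [K] under this embedding; by [pi_weyl_eta] the chosen representative is
    immaterial. As a subgroup, it can be fed to [generates] in [eta_gen]. *)
Definition weyl_eta_pred : {pred weyl (stab act y)} :=
  [pred q | eta act y (generic_quotient.repr q) \in K].

Lemma pi_weyl_eta n : (\pi_(weyl (stab act y)) n \in weyl_eta_pred)%qT = (eta act y n \in K).
Proof.
rewrite inE; have [eta_eq _] := pi_weyl_eq_eta
  (generic_quotient.repr (\pi_(weyl (stab act y)) n)%qT) n.
by rewrite eta_eq ?reprK.
Qed.

Lemma weyl_eta_group_closed : group_closed weyl_eta_pred.
Proof.
have pi1 : (1 = \pi_(weyl (stab act y)) 1)%qT by rewrite -[LHS]/(weyl_one _) piE.
split=> [|]; first by rewrite pi1 pi_weyl_eta eta1.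
elim/quotW=> a; elim/quotW=> b; rewrite !pi_weyl_eta => Ka Kb.
have -> : (\pi_(weyl (stab act y)) a * (\pi_(weyl (stab act y)) b)^-1 =
           \pi_(weyl (stab act y)) (a * b^-1))%qT.
  by rewrite pi_weylM; congr (_ * _); rewrite -[LHS]/(weyl_inv _) piE.
rewrite pi_weyl_eta etaM groupM //.
suff -> : eta act y b^-1 = (eta act y b)^-1 by rewrite groupV.
by apply: (mulgI (eta act y b)); rewrite -etaM !mulgV eta1.
Qed.

Definition weyl_eta : groupClosed (weyl (stab act y)) :=
  HB.pack_for (groupClosed (weyl (stab act y))) weyl_eta_pred
    (isInvClosed.Build _ weyl_eta_pred (group_closedV weyl_eta_group_closed))
    (isMul1Closed.Build _ weyl_eta_pred weyl_eta_group_closed.1)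
    (isMulClosed.Build _ weyl_eta_pred (group_closedM weyl_eta_group_closed)).

Lemma eta_gen k (n : 'I_k -> normaliser_of (stab act y)) :
    generates (range (fun i => \pi_(weyl (stab act y)) (n i)))%qT ->
    (forall i, eta act y (n i) \in K) ->
  forall m, eta act y m \in K.
Proof.
move=> n_gen Kn m; rewrite -pi_weyl_eta.
by apply: (n_gen weyl_eta _ _) => _ [i _ <-]; move: (Kn i); rewrite -pi_weyl_eta.
Qed.

End Generation.

End Eta.

(** * Orbit representatives and the lifts of their permutations *)

Section Representatives.
Local Open Scope group_scope.
Variables (G : groupType) (X : finType) (act : left_action G X).
Variables (r : nat) (x : 'I_r -> X).
Hypothesis x_inj : injective (fun i => conj_class (stab act (x i))).
Hypothesis x_enum : forall c,
  c \in Conj act <-> exists i, c = conj_class (stab act (x i)).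
Implicit Types (g h : G) (y z p : X) (i : 'I_r).

Lemma in_conjset (H : groupClosed G) g h : conjset H g h <-> h ^ g^-1 \in H.
Proof.
split=> [[k Hk <-]|Hh]; first by rewrite conjgK.
by exists (h ^ g^-1); rewrite // conjgKV.
Qed.

Lemma conjset_eqP (H K : groupClosed G) g k :
  conjset H g = conjset K k <-> forall h, (h ^ g^-1 \in H) = (h ^ k^-1 \in K).
Proof.
split=> [HK h|HK]; last by apply/seteqP; split=> h /in_conjset Hh; apply/in_conjset; rewrite ?HK // -HK.
by apply/idP/idP => /in_conjset; [rewrite HK | rewrite -HK] => /in_conjset.
Qed.

Lemma eq_conj_class (H K : groupClosed G) : H =i K -> conj_class H = conj_class K.
Proof.
move=> HK; apply/seteqP; split=> _ [g _ <-]; exists g => //;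
by apply/conjset_eqP => h; rewrite HK.
Qed.

Lemma conj_class_inP (H K : groupClosed G) :
  conj_class H = conj_class K -> exists g, forall h, (h \in H) = (h ^ g \in K).
Proof.
move=> HK; have : conj_class H (conjset H 1) by exists 1.
rewrite HK => -[g _ /conjset_eqP KH]; exists g^-1 => h.
by rewrite KH invg1 conjg1.
Qed.

Lemma conj_class_stab_act g y :
  conj_class (stab act (act g y)) = conj_class (stab act y).
Proof.
apply/seteqP; split=> _ [h _ <-].
  exists (g^-1 * h) => //; apply/conjset_eqP => k.
  by rewrite in_stab_act -conjgM invgM invgK.
exists (g * h) => //; apply/conjset_eqP => k.
by rewrite in_stab_act -conjgM invgM mulgKV.
Qed.

Lemma GorbitP y z : reflect (exists g, z = act g y) (z \in Gorbit act y).
Proof. by rewrite inE; apply: asboolP. Qed.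

Lemma Gorbit_act g y : Gorbit act (act g y) = Gorbit act y.
Proof.
apply/setP => z; apply/GorbitP/GorbitP => -[h ->].
  by exists (h * g); rewrite lactM.
by exists (h * g^-1); rewrite lactM lactK.
Qed.

Lemma class_exists y : exists i, conj_class (stab act y) = conj_class (stab act (x i)).
Proof. by apply/x_enum; apply/imfsetP; exists y. Qed.

Definition cls y : 'I_r := projT1 (cid (class_exists y)).

Lemma clsE y : conj_class (stab act y) = conj_class (stab act (x (cls y))).
Proof. by rewrite /cls; case: cid. Qed.

Lemma cls_eq y i : conj_class (stab act y) = conj_class (stab act (x i)) -> cls y = i.
Proof. by rewrite clsE => /x_inj. Qed.

Lemma cls_x i : cls (x i) = i. Proof. exact: cls_eq. Qed.

Lemma cls_act g y : cls (act g y) = cls y.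
Proof. by apply: cls_eq; rewrite conj_class_stab_act clsE. Qed.

Lemma cls_Aut (a : {perm X}) y : a \in AutG act -> cls (a y) = cls y.
Proof.
by move=> aA; apply: cls_eq; rewrite -clsE; apply/eq_conj_class/stab_Aut.
Qed.

(* [x i] represents its own orbit; the default value is never used.           *)
Definition rep y : X :=
  odflt y [pick z in Gorbit act y | `[< stab act z =i stab act (x (cls z)) >] &&
     ((x (cls z) \in Gorbit act y) ==> (z == x (cls z)))].

(** The stabilizers along an orbit fill a conjugacy class, so some point has stabilizer equal, not
    just conjugate, to that of [x (cls y)]. Representatives in a common box can therefore be
    permuted equivariantly. *)
Lemma rep_spec y :
  [/\ rep y \in Gorbit act y, stab act (rep y) =i stab act (x (cls (rep y)))
    & x (cls (rep y)) \in Gorbit act y -> rep y = x (cls (rep y))].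
Proof.
rewrite /rep; case: pickP => [z /and3P[yz /asboolP stabz /implyP xz]|no] /=.
  by split=> // /xz/eqP.
have [/GorbitP[g xE]|xNy] := boolP (x (cls y) \in Gorbit act y).
  have /and3P[] := no (x (cls y)); split; first by apply/GorbitP; exists g.
    by rewrite cls_x; apply/asboolP.
  by rewrite cls_x eqxx implybT.
have [g gE] := conj_class_inP (esym (clsE y)).
have /and3P[] := no (act g y); split; first by apply/GorbitP; exists g.
  by apply/asboolP => h; rewrite cls_act in_stab_act -gE.
by rewrite cls_act (negPf xNy).
Qed.

Lemma repE y : exists g, act g (rep y) = y.
Proof.
have [/GorbitP[g yE] _ _] := rep_spec y.
by exists g^-1; rewrite yE lactK.
Qed.

Lemma cls_rep y : cls (rep y) = cls y.
Proof. by have [g E] := repE y; rewrite -{2}E cls_act. Qed.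

Lemma rep_act g y : rep (act g y) = rep y.
Proof.
rewrite /rep Gorbit_act; case: pickP => //= no.
have [yz /asboolP stabz xz] := rep_spec y; have := no (rep y).
rewrite unfold_in [X in X && _]yz stabz /=.
by case: (boolP (x _ \in _)) => // /xz ->; rewrite cls_x eqxx.
Qed.

Lemma rep_rep y : rep (rep y) = rep y.
Proof. by have [g E] := repE y; rewrite -{2}E rep_act. Qed.

Lemma rep_x i : rep (x i) = x i.
Proof.
have [_ _] := rep_spec (x i); rewrite cls_rep cls_x; apply.
by apply/GorbitP; exists 1; rewrite lact1.
Qed.

Lemma stab_rep y : rep y = y -> stab act y =i stab act (x (cls y)).
Proof. by move=> yE h; have [_ + _] := rep_spec y; rewrite !yE. Qed.

Definition box_reps i : {set X} := [set y | (rep y == y) && (cls y == i)].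

Lemma x_box_reps i : x i \in box_reps i.
Proof. by rewrite inE rep_x cls_x !eqxx. Qed.

Lemma in_box i y : (y \in box act (conj_class (stab act (x i)))) = (cls y == i).
Proof.
by rewrite inE; apply/eqP/eqP => [/cls_eq //|<-]; rewrite clsE.
Qed.

Lemma card_orbits_in_box i :
  #|orbits_in act (box act (conj_class (stab act (x i))))| = #|box_reps i|.
Proof.
rewrite -[RHS](card_in_imset (f := Gorbit act)) => [|y z].
  congr #|pred_of_set _|; apply/setP => B; apply/imsetP/imsetP => -[y].
    rewrite in_box => /eqP yi ->; exists (rep y).
      by rewrite inE rep_rep cls_rep yi !eqxx.
    by have [g E] := repE y; rewrite -{1}E Gorbit_act.
  by rewrite inE => /andP[_ yi ->]; exists y; rewrite // in_box.
rewrite !inE => /andP[/eqP yE _] /andP[/eqP zE _] E.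
have /GorbitP[g yz] : y \in Gorbit act z.
  by rewrite -E; apply/GorbitP; exists 1; rewrite lact1.
by rewrite -yE yz rep_act zE.
Qed.

Definition trans y : G := projT1 (cid (repE y)).

Lemma transE y : act (trans y) (rep y) = y.
Proof. by rewrite /trans; case: cid. Qed.

(** The direct product of the symmetric groups on the [box_reps i]. *)
Definition rep_sym : {set {perm X}} :=
  [set s | perm_on [set y | rep y == y] s & [forall y, cls (s y) == cls y]].

Lemma rep_sym_group_set : group_set rep_sym.
Proof.
apply/group_setP; split=> [|s t]; rewrite !inE.
  by rewrite perm_on1; apply/forallP => y; rewrite perm1.
move=> /andP[os /forallP cs] /andP[ot /forallP ct]; rewrite perm_onM //=.
by apply/forallP => y; rewrite permM (eqP (ct _)).
Qed.
Canonical rep_sym_group := Group rep_sym_group_set.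

Lemma rep_sym_rep s y : s \in rep_sym -> rep y = y -> rep (s y) = s y.
Proof.
rewrite inE => /andP[os _] yE; have := perm_closed y os.
by rewrite !inE yE eqxx => /eqP.
Qed.

Lemma rep_sym_cls s y : s \in rep_sym -> cls (s y) = cls y.
Proof. by rewrite inE => /andP[_ /forallP/(_ y)/eqP]. Qed.

Lemma sub_rep_sym i s : perm_on (box_reps i) s -> s \in rep_sym.
Proof.
move=> os; rewrite inE; apply/andP; split.
  by apply: fintype.subset_trans os _; apply/fintype.subsetP => y; rewrite !inE => /andP[].
apply/forallP => y; have [yi|yi] := boolP (y \in box_reps i).
  have := perm_closed y os; rewrite yi !inE => /andP[_ /eqP->].
  by move: yi; rewrite inE => /andP[_ /eqP->].
by rewrite (out_perm os yi).
Qed.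

Definition rep_lift_fun (s : {perm X}) y : X := act (trans y) (s (rep y)).

(** The default [1] never occurs on [rep_sym], by [rep_lift_fun_inj]. *)
Definition rep_lift s : {perm X} :=
  if injectiveP (rep_lift_fun s) is ReflectT inj then perm inj else 1.

(** [p] and [s p] have the same stabilizer; this makes the lift both well defined and injective. *)
Lemma act_rep_sym s p g h : s \in rep_sym -> rep p = p ->
  (act g (s p) == act h (s p)) = (act g p == act h p).
Proof.
move=> sS pE; rewrite !act_eq (stab_rep pE) (stab_rep (rep_sym_rep sS pE)).
by rewrite rep_sym_cls.
Qed.

Lemma rep_lift_funE s g p : s \in rep_sym -> rep p = p ->
  rep_lift_fun s (act g p) = act g (s p).
Proof.
move=> sS pE; apply/eqP; rewrite /rep_lift_fun rep_act pE act_rep_sym //.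
by rewrite -{2}pE -(rep_act g) transE.
Qed.

Lemma rep_lift_fun_inj s : s \in rep_sym -> injective (rep_lift_fun s).
Proof.
move=> sS y z E; rewrite -(transE y) -(transE z).
have Eyz : rep y = rep z.
  apply: (perm_inj (s := s)); have := congr1 rep E.
  by rewrite !rep_act !(rep_sym_rep sS) ?rep_rep.
by apply/eqP; move/eqP: E; rewrite /rep_lift_fun Eyz act_rep_sym ?rep_rep.
Qed.

Lemma rep_liftE s g p : s \in rep_sym -> rep p = p -> rep_lift s (act g p) = act g (s p).
Proof.
move=> sS pE; rewrite /rep_lift; case: injectiveP => [inj|[]].
  by rewrite permE rep_lift_funE.
exact: rep_lift_fun_inj.
Qed.

Lemma rep_lift_rep s p : s \in rep_sym -> rep p = p -> rep_lift s p = s p.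
Proof. by move=> sS pE; have := rep_liftE 1 sS pE; rewrite !lact1. Qed.

Lemma rep_liftM : {in rep_sym &, {morph rep_lift : s t / s * t}}.
Proof.
move=> s t sS tS; apply/permP => y; rewrite -(transE y) permM.
by rewrite !rep_liftE ?groupM ?rep_sym_rep ?rep_rep ?permM.
Qed.
Canonical rep_lift_morphism := Morphism rep_liftM.

Lemma rep_lift_Aut s : s \in rep_sym -> rep_lift s \in AutG act.
Proof.
move=> sS; apply/AutGP => g y.
by rewrite -(transE y) -lactM !rep_liftE ?rep_rep // lactM.
Qed.

Lemma Aut_ext (a b : {perm X}) : a \in AutG act -> b \in AutG act ->
  (forall p, rep p = p -> a p = b p) -> a = b.
Proof.
move=> /AutGP aE /AutGP bE ab; apply/permP => y.
by rewrite -(transE y) aE bE ab ?rep_rep.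
Qed.

Lemma tperm_rep_sym i y z :
  y \in box_reps i -> z \in box_reps i -> tperm y z \in rep_sym.
Proof.
move=> yi zi; apply: (@sub_rep_sym i); apply/fintype.subsetP => t; rewrite inE.
by case: tpermP => [->|->|] //; rewrite eqxx.
Qed.

(* Repairing the images of the representatives one at a time: a swap puts the *)
(* image of [y] back into its orbit, and a conjugate of some [eta (x i) n]    *)
(* then brings it back to [y].                                                *)
Lemma Aut_gen (K : {group {perm X}}) :
    (forall i n, eta act (x i) n \in K) ->
    (forall i, {in box_reps i &, forall y z, rep_lift (tperm y z) \in K}) ->
  AutG act \subset K.
Proof.
move=> etaK liftK; apply/fintype.subsetP => a.
(* Induction on the number of representatives moved by [a]. *)
have [k] := ubnP #|[set y | (rep y == y) && (a y != y)]|.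
elim: k a => // k IHk a ak aA.
have [/existsP[y /andP[/eqP yE ayE]]|/existsPn fix_a] :=
    boolP [exists y, (rep y == y) && (a y != y)]; last first.
  rewrite (_ : a = 1) //; apply: Aut_ext => // p pE.
  by have := fix_a p; rewrite pE eqxx negbK perm1 => /eqP.
set p := rep (a y); set i := cls y.
have yi : y \in box_reps i by rewrite inE yE !eqxx.
have pi : p \in box_reps i by rewrite inE rep_rep cls_rep cls_Aut ?eqxx.
have xi := x_box_reps i.
set s := rep_lift (tperm y p); set t := rep_lift (tperm y (x i)).
have sS := tperm_rep_sym yi pi; have tS := tperm_rep_sym yi xi.
have sK : s \in K by apply: liftK yi pi.
have tK : t \in K by apply: liftK yi xi.
set g := trans (a y).
have byE : (a * s) y = act g y.
  by rewrite permM -{1}(transE (a y)) rep_liftE ?rep_rep // tpermR.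
have bA : a * s \in AutG act by rewrite groupM ?rep_lift_Aut.
(* [g y] is the image of [y] under an automorphism, so both points have the same stabilizer. *)
have gN : g \in Defs.normaliser (stab act (x i)).
  apply/Defs.normaliserP => h; have stab_xi : stab act (x i) =i stab act y.
    by move=> h'; rewrite (stab_rep yE).
  by rewrite !stab_xi -in_stab_act -byE stab_Aut.
pose n : normaliser_of (stab act (x i)) := Sub g gN.
pose e := eta act (x i) n ^ t.
have eK : e \in K by rewrite groupJ ?etaK.
have eA : e \in AutG act by rewrite groupJ ?eta_Aut ?rep_lift_Aut.
have tx : t (x i) = y by rewrite /t rep_lift_rep ?rep_x // tpermR.
have tgx : t (act g (x i)) = act g y by rewrite /t rep_liftE ?rep_x // tpermR.
have eyE : e y = act g y by rewrite -[in LHS]tx permJ eta_base SubK.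
(* [t] transports the orbit of [x i] to that of [y], and [y] is the only representative there. *)
have eout q : rep q = q -> q != y -> e q = q.
  move=> qE qy; pose q' := tperm y (x i) q.
  have q'E : rep q' = q' by rewrite rep_sym_rep.
  have q'x : q' != x i.
    by apply: contraNneq qy => /(congr1 (tperm y (x i))); rewrite tpermK tpermR => ->.
  have tq' : t q' = q by rewrite /t rep_lift_rep // tpermK.
  rewrite -[in LHS]tq' permJ eta_out ?tq' // => -[h E].
  by case/eqP: q'x; rewrite -q'E -E rep_act rep_x.
suff cK : a * s * e^-1 \in K by rewrite -(groupMr a sK) -(groupMr (a * s) (groupVr eK)).
have cy : (a * s * e^-1) y = y by rewrite permM byE -eyE permK.
apply: IHk; last by rewrite groupM ?groupV.
rewrite -ltnS (leq_trans _ ak) // ltnS; apply: proper_card; apply/properP; split.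
  apply/fintype.subsetP => z; rewrite !inE => /andP[zE]; rewrite zE; apply: contraNN => /eqP az.
  have [->|zy] := eqVneq z y; first by rewrite cy.
  rewrite !permM az.
  (* If [a] fixed [p], then [y] would lie in the orbit of [p], forcing [y = p = z]. *)
  have zp : z != p.
    apply: contraNneq zy => zp; apply/eqP.
    have := congr1 rep (congr1 (fun w => a^-1 w) (transE (a y))).
    have /AutGP -> : a^-1 \in AutG act by rewrite groupV.
    by rewrite rep_act -/p -zp permK yE -{1}az permK (eqP zE).
  rewrite /s rep_lift_rep ?(eqP zE) // tpermD 1?eq_sym //.
  by rewrite -[X in e^-1 X](eout z) ?permK // (eqP zE).
by exists y; rewrite !inE yE eqxx ?ayE //= cy eqxx.
Qed.

(** Pairs from different boxes have disjoint supports and so commute, which allows interleaving. If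
    no box has three orbits, all [c i] are trivial and the lifted involutions suffice. *)
Lemma box_symmetries_gen :
  exists2 S : {set {perm X}},
    #|S| <= #|[set i | 1 < #|box_reps i|]| + [exists i, 2 < #|box_reps i|] &
    S \subset AutG act /\
    forall K : {group {perm X}}, S \subset K ->
      forall i, {in box_reps i &, forall y z, rep_lift (tperm y z) \in K}.
Proof.
have /choice[cd cdP] : forall i, exists cd : {perm X} * {perm X},
    [/\ perm_on (box_reps i) cd.1, perm_on (box_reps i) cd.2, odd #[cd.1], cd.2 ^+ 2 = 1
      & #|box_reps i| <= 2 -> cd.1 = 1] /\
    forall K : {group {perm X}}, cd.1 \in K -> cd.2 \in K ->
      {in box_reps i &, forall y z, tperm y z \in K}.
  by move=> i; have [cd ? ?] := Sym_gen_odd_cycle (box_reps i); exists cd.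
have SymS i : (cd i).1 \in rep_sym /\ (cd i).2 \in rep_sym.
  by have [[ci di _ _ _] _] := cdP i; split; apply: sub_rep_sym; [exact: ci | exact: di].
have liftX s k : s \in rep_sym -> rep_lift s ^+ k = rep_lift (s ^+ k).
  by move=> sS; rewrite (morphX rep_lift_morphism).
have lift1 : rep_lift 1 = 1 by rewrite (morph1 rep_lift_morphism).
pose c i := rep_lift (cd i).1; pose d i := rep_lift (cd i).2.
have cdA i : c i \in AutG act /\ d i \in AutG act.
  by have [cS dS] := SymS i; split; apply: rep_lift_Aut.
have cdK (K : {group {perm X}}) : 
    (forall i, 1 < #|box_reps i| -> c i \in K /\ d i \in K) ->
  forall i, {in box_reps i &, forall y z, rep_lift (tperm y z) \in K}.
  move=> KP i y z yi zi; have [ci1|ci1] := leqP #|box_reps i| 1.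
    by rewrite (card_le1_eqP ci1 y z) // tperm1 lift1 group1.
  have [_ genT] := cdP i; have [ciK diK] := KP i ci1; have [cS dS] := SymS i.
  (* Membership in [K] is pulled back to the symmetric group on the representatives. *)
  have := genT (rep_lift_morphism @*^-1 K)%G.
  rewrite !mem_morphpre // => /(_ isT isT y z yi zi).
  by case/morphpreP.
have [big|small] := boolP [exists i, 2 < #|box_reps i|]; last first.
  exists [set d i | i in [set i | 1 < #|box_reps i|]].
    by rewrite addn0 leq_imset_card.
  split=> [|K dK].
    by apply/fintype.subsetP => _ /imsetP[i _ ->]; have [] := cdA i.
  apply: cdK => i i2; split; last first.
    by apply: (fintype.subsetP dK); apply: imset_f; rewrite inE.
  have [[_ _ _ _ c1] _] := cdP i; rewrite /c c1 ?lift1 ?group1 //.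
  by move/existsPn/(_ i): small; rewrite -leqNgt.
(* Starting from the involution [1], the first product is [c] alone. *)
have [|i||i j ij||S cS genS] :=
    @interleaved_gen _ _ c d (enum [set i | 1 < #|box_reps i|]) 1.
- exact: expg1n.
- have [[_ _ oc d2 _] _] := cdP i; have [ciS diS] := SymS i; split.
    exact: dvdn_odd (morph_order rep_lift_morphism ciS) oc.
  by rewrite /d liftX // d2.
- by move=> i _; apply: commute_sym; apply: commute1.
- have [[_ di _ _ _] _] := cdP i; have [[cj _ _ _ _] _] := cdP j.
  have [_ diS] := SymS i; have [cjS _] := SymS j.
  rewrite /commute /c /d -![rep_lift _ * rep_lift _](morphM rep_lift_morphism) //.
  congr rep_lift; apply: perm_onC di cj _.
  rewrite -setI_eq0; apply/eqP/setP => y; rewrite !inE.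
  apply/negP => /andP[/andP[_ /eqP yi] /andP[_ /eqP yj]].
  by rewrite -yi yj eqxx in ij.
- exact: enum_uniq.
exists S; first by rewrite -cardE in cS; rewrite addn1.
split=> [|K /genS[_ lK]].
  (* The equivalence, applied to Aut_G(X) itself, shows that [S] consists of automorphisms. *)
  by apply/(genS (AutG_group act)); split; [exact: group1 | move=> i _; exact: cdA].
by apply: cdK => i i2; apply: lK; rewrite mem_enum inE.
Qed.

Lemma card_fset_classes (A : {fset set (set G)}) (P : pred 'I_r) :
    (forall c, c \in A <-> exists2 i, P i & c = conj_class (stab act (x i))) ->
  #|` A| = #|P|.
Proof.
move=> AP; rewrite [RHS]cardE -(size_map (fun i => conj_class (stab act (x i)))).
apply/perm_size/uniq_perm; rewrite ?fset_uniq ?(map_inj_uniq x_inj) ?enum_uniq // => c.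
apply/idP/mapP => [/AP[i Pi cE]|[i Pi cE]]; first by exists i; rewrite ?mem_enum.
by apply/AP; exists i => //; rewrite mem_enum in Pi.
Qed.

Lemma card_Conj_kappa :
  (#|` Conj act| - kappa act)%N = #|[set i | 1 < #|box_reps i|]|.
Proof.
rewrite (@card_fset_classes _ xpredT); last first.
  by move=> c; rewrite x_enum; split=> [[i ->]|[i _ ->]]; exists i.
rewrite /kappa (@card_fset_classes _ [pred i | #|box_reps i| == 1%N]) => [|c].
  rewrite -(cardC [pred i | #|box_reps i| == 1%N]) addKn cardsE.
  apply: eq_card => i; rewrite !inE unfold_in -[RHS]/(1 < #|box_reps i|) ltn_neqAle eq_sym.
  suff -> : 0 < #|box_reps i| by rewrite andbT.
  by apply/card_gt0P; exists (x i); apply: x_box_reps.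
rewrite !inE /=; split=> [/andP[/x_enum[i ->]]|[i Pi ->]].
  by rewrite card_orbits_in_box; exists i.
by apply/andP; split; [apply/x_enum; exists i | rewrite card_orbits_in_box].
Qed.

End Representatives.

(** * One generator per packet *)

Section PacketGeneration.
Local Open Scope group_scope.
Variables (gT : finGroupType) (r : nat) (m : 'I_r -> nat).
Variable e : forall i : 'I_r, 'I_(m i) -> gT.
Hypothesis e_comm : forall i j (k : 'I_(m i)) (l : 'I_(m j)),
  i != j -> commute (e k) (e l).

(** Distinct members of a packet have different superscripts, hence commute. *)
Lemma packet_cyclic (P : {set gT}) :
  packet e P -> exists2 g, g \in <<base e>> & P \subset <[g]>.
Proof.
case/and3P => sPb /forall_inP coP /forallP indP.
have [a b|a b||g [gP _ Pg]] := @coprime_commuting_cyclic _ (enum P).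
- rewrite !mem_enum => aP bP.
  have := fintype.subsetP sPb _ aP; have := fintype.subsetP sPb _ bP.
  rewrite !inE => /andP[/existsP[j /existsP[l /eqP bE]] _].
  move=> /andP[/existsP[i /existsP[k /eqP aE]] _].
  have [ij|] := eqVneq i j; last by rewrite aE bE; apply: e_comm.
  case: j / ij l bE => l bE.
  have /forallP/(_ k)/forallP/(_ l) := indP i.
  by rewrite -aE -bE aP bP => /eqP->.
- by rewrite !mem_enum => /coP/forall_inP/(_ b) H /H/implyP.
- exact: enum_uniq.
exists g; last by apply/fintype.subsetP => a aP; apply: Pg; rewrite mem_enum.
move: g gP {Pg}; apply/fintype.subsetP/genS/fintype.subsetP => a.
by rewrite inE mem_enum => /(fintype.subsetP sPb).
Qed.

Lemma packets_gen :
  exists2 S : {set gT}, #|S| <= lambda_min e &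
    S \subset <<base e>> /\
    forall K : {group gT}, S \subset K -> forall i (k : 'I_(m i)), e k \in K.
Proof.
rewrite /lambda_min; case: arg_minnP => [|P /andP[partP /forall_inP packP] _].
  exact: packet_partition1.
have /choice[f fP] : forall Q, exists g, Q \in P -> g \in <<base e>> /\ Q \subset <[g]>.
  move=> Q; have [/packP/packet_cyclic[g gb Qg]|] := boolP (Q \in P); last by exists 1.
  by exists g.
exists (f @: P); first exact: leq_imset_card.
split=> [|K fK i k].
  by apply/fintype.subsetP => _ /imsetP[Q /fP[gb _] ->].
(* Trivial generators belong to no packet, but lie in every subgroup. *)
have [ek1|ek1] := leqP #[e k] 1.
  have -> : e k = 1; last exact: group1.
  by apply/eqP; rewrite -order_eq1 eqn_leq ek1 order_gt0.
have : e k \in base e.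
  by rewrite inE ek1 andbT; apply/existsP; exists i; apply/existsP; exists k.
have /and3P[/eqP <- _ _] := partP.
case/bigcupP => Q QP ekQ; have [_ /fintype.subsetP/(_ _ ekQ)] := fP Q QP.
move: (e k); apply/fintype.subsetP; rewrite cycle_subG.
by apply: (fintype.subsetP fK); apply: imset_f.
Qed.

End PacketGeneration.

(** * Assembling the bound *)

Local Open Scope fset_scope.
Local Open Scope quotient_scope.

Theorem corollary19 (G : groupType) (X : finType) (act : left_action G X)
    (r : nat) (x : 'I_r -> X)
    (x_inj : injective (fun i => conj_class (stab act (x i))))
    (x_enum : forall c, c \in Conj act <-> exists i, c = conj_class (stab act (x i)))
    (m : 'I_r -> nat)
    (n : forall i, 'I_(m i) -> normaliser_of (stab act (x i)))
    (n_gen : forall i,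
       min_generating (fun k => \pi_(weyl (stab act (x i))) (n i k))) :
  Rank (AutG_group act) <=
    #|` Conj act| - kappa act + Lambda act +
    lambda_min (fun i k => eta act (x i) (n i k)).
Proof.
set e := fun i k => eta act (x i) (n i k).
(* Points with non-conjugate stabilizers lie in different orbits. *)
have e_comm i j (k : 'I_(m i)) (l : 'I_(m j)) : i != j -> commute (e i k) (e j l).
  move=> ij; apply: commute_eta => g xE; case/eqP: ij; apply: x_inj.
  by rewrite -xE conj_class_stab_act.
have [S1 cS1 [S1b S1K]] := packets_gen e_comm.
have [S2 cS2 [S2A S2K]] := box_symmetries_gen x_inj x_enum.
pose Reps := box_reps x_enum.
have AutE : AutG act = <<S1 :|: S2>>%g.
  apply/eqP; rewrite finset.eqEsubset; apply/andP; split; last first.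
    rewrite gen_subG finset.subUset S2A andbT (fintype.subset_trans S1b) // gen_subG.
    apply/fintype.subsetP => s; rewrite inE => /andP[/existsP[i /existsP[k /eqP->]] _].
    exact: eta_Aut.
  apply: (Aut_gen (x_inj := x_inj) (x_enum := x_enum)) => [i|i].
    apply: (eta_gen (n_gen i).1) => k; apply: (S1K _ _ i k).
    by rewrite (fintype.subset_trans _ (subset_gen _)) // finset.subsetUl.
  apply: S2K; by rewrite (fintype.subset_trans _ (subset_gen _)) // finset.subsetUr.
have cS : 'm(AutG act)%g <= #|` Conj act| - kappa act + [exists i, 2 < #|Reps i|] + lambda_min e.
  rewrite AutE (leq_trans (grank_min _)) // (leq_trans (leq_card_setU _ _)) // addnC.
  by rewrite (card_Conj_kappa x_inj x_enum) leq_add.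
have [big|small] := boolP [exists i, 2 < #|Reps i|].
  have -> : Lambda act = 1.
    apply: (congr1 nat_of_bool (y := true)); apply/asboolP; right; have /existsP[i i3] := big.
    exists (conj_class (stab act (x i))); first by apply/x_enum; exists i.
    by rewrite (card_orbits_in_box x_inj x_enum).
  by rewrite big in cS; rewrite /Rank geq_max cS addn1 addSn.
rewrite (negPf small) addn0 in cS.
have cS' : 'm(AutG act)%g <= #|` Conj act| - kappa act + Lambda act + lambda_min e.
  by rewrite (leq_trans cS) // leq_add2r leq_addr.
(* It remains to see that the bound is at least 1; suppose that all three terms vanish. *)
rewrite /Rank geq_max cS' andbT lt0n; apply/negP; rewrite !addn_eq0 => /andP[/andP[t0 /eqP L0] l0].
rewrite (eqP t0) (eqP l0) leqn0 in cS.
have A1 : AutG act = 1%g.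
  have [B /= AE /eqP] := grank_witness (AutG_group act).
  by rewrite (eqP cS) cards_eq0 -AE => /eqP->; exact: gen0.
suff : Lambda act = 1 by rewrite L0.
apply: (congr1 nat_of_bool (y := true)); apply/asboolP; left; split.
  apply/eqP; rewrite eqn_leq -subn_eq0 t0 /=.
  apply: fsubset_leq_card; exact: fset_sub.
move=> H /x_enum[i HE]; elim/quotW => a.
(* [H] is only conjugate to the stabilizer of [x i], but it is the stabilizer of a translate, on
   whose orbit N_G(H)/H acts faithfully. *)
have [g gE] := conj_class_inP HE.
have Hst : H =i stab act (act g (x i)) by move=> h; rewrite in_stab_act gE.
have aN : val a \in Defs.normaliser (stab act (act g (x i))).
  apply/Defs.normaliserP => h; rewrite -!Hst; exact: (Defs.normaliserP _ _ (valP a)).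
have : eta act (act g (x i)) (Sub (val a) aN) = 1%g.
  by apply/set1gP; rewrite -A1 eta_Aut.
move=> /permP/(_ (act g (x i))); rewrite perm1 eta_base SubK => /eqP.
rewrite -in_stab -Hst => aH.
have -> : (1 = \pi_(weyl H) 1)%g by rewrite -[LHS]/(weyl_one _) piE.
by apply/esym/weyl_piP; rewrite /= invg1 mul1g.
Qed.
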